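(* The unique map $(L^1, I) \to (\mathbb{F}, t)$ in $\mathscr{B}^1_{\mathrm{emb}}$ is the family of integration operators $\bigl( \int_X \colon L^1(X) \to \mathbb{F} \bigr)$ indexed by all (finite) measure spaces $X$.
   Context: $\mathbb{F}$ is a fixed field, either $\mathbb{R}$ or $\mathbb{C}$. $\mathbf{Ban}$ is the category of Banach spaces over $\mathbb{F}$ and linear contractions (linear maps of norm $\le 1$). All measure spaces are finite, i.e. $\mu_X(X) < \infty$, where $\mu_X$ denotes the measure on $X$ (the empty measure space is allowed). An embedding $i \colon Y \to X$ of measure spaces is an injection such that $B \subseteq Y$ is measurable if and only if $iB \subseteq X$ is measurable, and in that case $\mu_Y(B) = \mu_X(iB)$. $\mathbf{Mea}_{\mathrm{emb}}$ is the category of measure spaces and embeddings. Two embeddings $i \colon Y \to X$ and $j \colon Z \to X$ are complementary if $iY \cap jZ = \emptyset$ and $iY \cup jZ = X$. $\mathscr{B}^1_{\mathrm{emb}}$ is the category of pairs $(F, v)$ consisting of a functor $F \colon \mathbf{Mea}_{\mathrm{emb}} \to \mathbf{Ban}$ and an element $v_X \in F(X)$ for each measure space $X$, such that: (I) $(Fi)(v_Y) + (Fj)(v_Z) = v_X$ for all complementary embeddings $i \colon Y \to X$, $j \colon Z \to X$; (III) $\|v_X\| \le \mu_X(X)$ for every $X$; (IV) $\|(Fi)(u) + (Fj)(w)\| \le \|u\| + \|w\|$ for all such $i, j$ and $u \in F(Y)$, $w \in F(Z)$ (this last axiom being automatic). A map $(F', v') \to (F, v)$ is a natural transformation $\psi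 \colon F' \to F$ such that $\psi_X(v'_X) = v_X$ for all $X$. $L^1 \colon \mathbf{Mea}_{\mathrm{emb}} \to \mathbf{Ban}$ sends $X$ to the usual space $L^1(X)$ of $\mathbb{F}$-valued functions and acts on embeddings by extension by zero; $I_X \in L^1(X)$ is the constant function $1$. $(L^1, I)$ is the initial object of $\mathscr{B}^1_{\mathrm{emb}}$. The constant functor $\mathbb{F} \colon \mathbf{Mea}_{\mathrm{emb}} \to \mathbf{Ban}$ sends every measure space to $\mathbb{F}$ and every embedding to $\mathrm{id}_{\mathbb{F}}$, and $t_X = \mu_X(X) \in \mathbb{F}$; $(\mathbb{F}, t)$ is an object of $\mathscr{B}^1_{\mathrm{emb}}$. *)

(* Defs.v *)
From HB Require Import structures.
From mathcomp Require Import all_boot all_order all_algebra.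
From mathcomp Require Import all_classical all_reals all_analysis.
From mathcomp Require Import measurable_realfun.
From mathcomp Require Import complex generic_quotient ring_quotient.
Set Implicit Arguments.
Unset Strict Implicit.
Unset Printing Implicit Defensive.
Import Order.TTheory GRing.Theory Num.Theory.
Import numFieldNormedType.Exports.
Local Open Scope classical_set_scope.
Local Open Scope ring_scope.
Local Open Scope quotient_scope.

Inductive ground_field := Reals | Complexes.

Definition scalar (R : realType) (k : ground_field) : numFieldType :=
  match k with Reals => R | Complexes => R[i] end.

Definition reS (R : realType) (k : ground_field) : scalar R k -> R :=
  match k with Reals => fun a => a | Complexes => @complex.Re R end.

Definition imS (R : realType) (k : ground_field) : scalar R k -> R :=
  match k with Reals => fun=> 0 | Complexes => @complex.Im R end.

(* a + ib; over the reals the imaginary part is dropped *)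
Definition mkS (R : realType) (k : ground_field) : R -> R -> scalar R k :=
  match k with Reals => fun a _ => a | Complexes => fun a b => Complex a b end.

Definition ofR (R : realType) (k : ground_field) (a : R) : scalar R k :=
  mkS k a 0.
Arguments ofR {R} k a.

(* the modulus of z, as a real number: the norm of scalar R k is valued in
   scalar R k itself *)
Definition absS (R : realType) (k : ground_field) (z : scalar R k) : R :=
  reS `|z|.

Section scalar_theory.
Context {R : realType} {k : ground_field}.
Implicit Types (a b : R) (z w : scalar R k).

Lemma reSD z w : reS (z + w) = reS z + reS w.
Proof. by case: k z w => // -[a b] [c d]. Qed.

Lemma imSD z w : imS (z + w) = imS z + imS w.
Proof. by case: k z w => [z w|[a b] [c d]] //=; rewrite addr0. Qed.

Lemma reSN z : reS (- z) = - reS z.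
Proof. by case: k z => // -[a b]. Qed.

Lemma imSN z : imS (- z) = - imS z.
Proof. by case: k z => [z|[a b]] //=; rewrite oppr0. Qed.

Lemma reSB z w : reS (z - w) = reS z - reS w.
Proof. by rewrite reSD reSN. Qed.

Lemma imSB z w : imS (z - w) = imS z - imS w.
Proof. by rewrite imSD imSN. Qed.

Lemma reSM z w : reS (z * w) = reS z * reS w - imS z * imS w.
Proof. by case: k z w => [z w|[a b] [c d]] //=; rewrite mulr0 subr0. Qed.

Lemma imSM z w : imS (z * w) = reS z * imS w + imS z * reS w.
Proof. by case: k z w => [z w|[a b] [c d]] //=; rewrite mulr0 mul0r addr0. Qed.

Lemma reS0 : reS (0 : scalar R k) = 0. Proof. by case: k. Qed.
Lemma imS0 : imS (0 : scalar R k) = 0. Proof. by case: k. Qed.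
Lemma reS1 : reS (1 : scalar R k) = 1. Proof. by case: k. Qed.
Lemma imS1 : imS (1 : scalar R k) = 0. Proof. by case: k. Qed.

Lemma scalar_ext z w : reS z = reS w -> imS z = imS w -> z = w.
Proof. by case: k z w => //= -[a b] [c d] /= -> ->. Qed.

Lemma mkS_re_im z : mkS k (reS z) (imS z) = z.
Proof. by case: k z => //= -[]. Qed.

Lemma reS_mkS a b : reS (mkS k a b) = a. Proof. by case: k. Qed.

Lemma imS_mkS a b : imS (mkS k a b) = b \/ (k = Reals /\ imS (mkS k a b) = 0).
Proof. by case: k; [right|left]. Qed.

Lemma mkSD a b c d : mkS k (a + c) (b + d) = mkS k a b + mkS k c d.
Proof. by case: k. Qed.

Lemma mkSB a b c d : mkS k (a - c) (b - d) = mkS k a b - mkS k c d.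
Proof. by case: k. Qed.

Lemma reS_ofR a : reS (ofR k a) = a. Proof. exact: reS_mkS. Qed.
Lemma imS_ofR a : imS (ofR k a) = 0. Proof. by rewrite /ofR; case: k. Qed.

Lemma ofR0 : ofR k (0 : R) = 0. Proof. by case: k. Qed.
Lemma ofR1 : ofR k (1 : R) = 1. Proof. by case: k. Qed.
Lemma ofRD a b : ofR k (a + b) = ofR k a + ofR k b.
Proof. by rewrite /ofR -mkSD addr0. Qed.
Lemma ofRM a b : ofR k (a * b) = ofR k a * ofR k b.
Proof. by apply: scalar_ext; rewrite ?(reSM, imSM, reS_ofR, imS_ofR) ?mulr0 ?mul0r ?subr0 ?addr0. Qed.

Lemma ler_ofR a b : (ofR k a <= ofR k b) = (a <= b).
Proof. by rewrite /ofR; case: k => //=; rewrite lecE/= eqxx. Qed.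
Lemma ltr_ofR a b : (ofR k a < ofR k b) = (a < b).
Proof. by rewrite /ofR; case: k => //=; rewrite ltcE/= eqxx. Qed.
Lemma ofR_inj : injective (@ofR R k).
Proof. by move=> a b /(congr1 (@reS R k)); rewrite !reS_ofR. Qed.

Lemma ge0_scalar z : 0 <= z -> z = ofR k (reS z).
Proof.
by rewrite /ofR; case: k z => [//|[a b]] /=; rewrite lecE/= => /andP[/eqP-> _].
Qed.

Lemma normS z : `|z| = ofR k (absS z).
Proof. exact: ge0_scalar. Qed.

Lemma absS_ge0 z : 0 <= absS z.
Proof. by rewrite -ler_ofR -normS ofR0. Qed.

Lemma absSE z : absS z = Num.sqrt ((reS z) ^+ 2 + (imS z) ^+ 2).
Proof.
rewrite /absS; case: k z => [z|z] /=; first by rewrite expr0n addr0 sqrtr_sqr.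
exact: (congr1 (@complex.Re R) (normc_def z)).
Qed.

Lemma absSD z w : absS (z + w) <= absS z + absS w.
Proof. by rewrite -ler_ofR ofRD -!normS ler_normD. Qed.
Lemma absSM z w : absS (z * w) = absS z * absS w.
Proof. by apply: ofR_inj; rewrite ofRM -!normS normrM. Qed.
Lemma absSN z : absS (- z) = absS z.
Proof. by rewrite /absS normrN. Qed.
Lemma absS_eq0 z : absS z = 0 -> z = 0.
Proof. by move=> z0; apply/normr0_eq0; rewrite normS z0 ofR0. Qed.
Lemma absS0 : absS (0 : scalar R k) = 0.
Proof. by rewrite /absS normr0 reS0. Qed.
Lemma absS1 : absS (1 : scalar R k) = 1.
Proof. by rewrite /absS normr1 reS1. Qed.

Lemma absS_re z : `|reS z| <= absS z.
Proof. by rewrite absSE -sqrtr_sqr ler_wsqrtr// lerDl sqr_ge0. Qed.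
Lemma absS_im z : `|imS z| <= absS z.
Proof. by rewrite absSE -sqrtr_sqr ler_wsqrtr// lerDr sqr_ge0. Qed.

Lemma absS_ofR a : absS (ofR k a) = `|a|.
Proof. by rewrite absSE reS_ofR imS_ofR expr0n/= addr0 sqrtr_sqr. Qed.

Lemma absS_mkS a b : absS (mkS k a b) <= `|a| + `|b|.
Proof.
rewrite absSE -[leRHS]ger0_norm ?addr_ge0// -sqrtr_sqr ler_wsqrtr//.
have h : a ^+ 2 + b ^+ 2 <= (`|a| + `|b|) ^+ 2.
  by rewrite sqrrD !real_normK ?num_real// addrAC lerDl mulrn_wge0// mulr_ge0.
have [->|[_ ->]] := imS_mkS a b; rewrite reS_mkS//.
by apply: le_trans h; rewrite expr0n/= addr0 lerDl sqr_ge0.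
Qed.

End scalar_theory.

(* the ground field as a one-dimensional Banach space over itself *)
Definition scalar_space (R : realType) (k : ground_field) : Type := scalar R k.
HB.instance Definition _ (R : realType) (k : ground_field) :=
  NormedModule.copy (scalar_space R k) ((scalar R k)^o).

Lemma scalar_complete (R : realType) (k : ground_field)
    (F : set_system (scalar_space R k)) :
  ProperFilter F -> cauchy F -> cvg F.
Proof.
move=> FF Fc.
have cproj (p : scalar R k -> R) : (forall z w, p (z - w) = p z - p w) ->
    (forall z, `|p z| <= absS z) -> exists l : R, (p @ F) --> l.
  move=> pB plip; apply/cvg_ex; apply: (@R_complete R).
  apply/cauchy_ballP => e e0.
  have oe0 : 0 < ofR k e by rewrite -(@ofR0 R k) ltr_ofR.
  move/cauchy_ballP : Fc => /(_ _ oe0).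
  rewrite !near_simpl => -[[A B] /= [FA FB] AB].
  exists (p @` A, p @` B) => /=.
    split; [apply: filterS FA => z Az|apply: filterS FB => z Bz]; by exists z.
  move=> [_ _] /= [[z Az <-] [w Bw <-]].
  have := AB (z, w) (conj Az Bw).
  rewrite -!ball_normE/= normS ltr_ofR => zw.
  by rewrite -pB (le_lt_trans (plip _)).
have [a Fa] := cproj (@reS R k) reSB absS_re.
have [b Fb] := cproj (@imS R k) imSB absS_im.
apply/cvg_ex; exists (mkS k a b : scalar_space R k).
apply/cvgrPdist_lt => e e0.
have eE := ge0_scalar (ltW e0).
have re0 : 0 < reS e / 2 by rewrite divr_gt0// -(@ltr_ofR R k) -eE ofR0.
move/cvgrPdist_lt : Fa => /(_ _ re0); rewrite near_simpl => Fa.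
move/cvgrPdist_lt : Fb => /(_ _ re0); rewrite near_simpl => Fb.
near=> z.
rewrite -[z](@mkS_re_im R k) -mkSB.
rewrite normS eE ltr_ofR (le_lt_trans (absS_mkS _ _))//.
rewrite [ltRHS]splitr ltrD//; near: z.
- exact: Fa.
- exact: Fb.
Unshelve. all: by end_near. Qed.

HB.instance Definition _ (R : realType) (k : ground_field) :=
  Uniform_isComplete.Build (scalar_space R k) (@scalar_complete R k).


Section real_L1_complete.
Context d (T : measurableType d) (R : realType).
Variable mu : {measure set T -> \bar R}.
Local Open Scope ereal_scope.

Lemma geo_sum n : \sum_(0 <= j <oo) ((2 * 2^-1 ^+ (j + n))%:E : \bar R) = (4 * 2^-1 ^+ n)%:E.
Proof.
rewrite (_ : (fun _ => _) = EFin \o series (geometric (2 * 2^-1 ^+ n)%R (2^-1)%R)); last first.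
  apply/funext => m /=; rewrite sumEFin; congr (_%:E).
  by apply: eq_bigr => j _; rewrite exprD /= -mulrA (mulrC (2^-1 ^+ n)%R).
apply/cvg_lim => //; apply: cvg_EFin; first by apply: nearW.
have -> : (4 * 2^-1 ^+ n = (2 * 2^-1 ^+ n) * (1 - 2^-1)^-1 :> R)%R.
  have -> : (1 - 2^-1 = 2^-1 :> R)%R by rewrite {1}[1%R](splitr 1%R) mul1r addrK.
  by rewrite invrK mulrAC -natrM.
apply: cvg_geometric_series.
by rewrite ger0_norm// invf_lt1// ltr1n.
Qed.

Lemma real_L1_complete (u : nat -> T -> R) :
  (forall n, measurable_fun [set: T] (u n)) ->
  (forall n, \int[mu]_x `|u n x - u n.+1 x|%:E <= (2 * 2^-1 ^+ n)%:E) ->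
  exists g : T -> R, [/\ measurable_fun [set: T] g,
    forall n, \int[mu]_x `|u n x - g x|%:E <= (4 * 2^-1 ^+ n)%:E &
    forall x, (forall n, u n x = 0%R) -> g x = 0%R].
Proof.
move=> mu_ du.
pose s n (x : T) : \bar R := \sum_(0 <= j <oo) `|u (j + n)%N x - u (j + n).+1 x|%:E.
pose w n (x : T) : R := `|u n x - u n.+1 x|%R.
have mdu n : measurable_fun [set: T] (EFin \o w n).
  by apply/measurable_EFinP; apply: measurableT_comp => //; exact: measurable_funB.
have ms n : measurable_fun [set: T] (s n).
  by apply: ge0_emeasurable_sum => //= j _; exact: mdu.
have is_ n : \int[mu]_x s n x <= (4 * 2^-1 ^+ n)%:E.
  rewrite integral_nneseries//; last first.
    by move=> j; exact: mdu.
  rewrite -geo_sum; apply: lee_nneseries => //.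
  by move=> j _ _; apply: integral_ge0.
have ps n x m : `|u n x - u (n + m)%N x|%:E <= s n x.
  have h : (`|u n x - u (n + m)%N x| <= \sum_(0 <= j < m) `|u (j + n)%N x - u (j + n).+1 x|)%R.
    elim: m => [|m ih]; first by rewrite addn0 subrr normr0 big_geq.
    rewrite big_nat_recr//= addnS (le_trans _ (lerD ih (lexx _)))//.
    by rewrite (addnC m n) ler_distD.
  apply: (@le_trans _ _ (\sum_(0 <= j < m) `|u (j + n)%N x - u (j + n).+1 x|%:E)).
    by rewrite sumEFin lee_fin.
  exact: nneseries_lim_ge.
pose D := [set x | s 0%N x < +oo].
have mD : measurable D.
  by rewrite -[D]setTI; apply: emeasurable_fun_infty_o => //; exact: ms.
pose v n x := (u n x * \1_D x)%R.
have mv n : measurable_fun [set: T] (v n).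
  by apply: measurable_funM => //; exact: measurable_indic.
have cv x : D x -> cvgn (u ^~ x).
  move=> Dx.
  have cs : cvgn (series (fun j => u j.+1 x - u j x)%R).
    apply: normed_cvg.
    apply: nondecreasing_is_cvgn.
      by apply: nondecreasing_series => j _ _ /=.
    exists (fine (s 0%N x)) => _ [m _ <-] /=.
    rewrite -lee_fin fineK; last first.
      rewrite ge0_fin_numE//; exact: nneseries_ge0.
    rewrite /series/= -sumEFin (le_trans _ (nneseries_lim_ge m _))//.
    by under [leRHS]eq_bigr do rewrite addn0 distrC.
  have -> : (u ^~ x) = (fun n => u 0%N x + series (fun j => u j.+1 x - u j x)%R n)%R.
    by apply/funext => n; rewrite /series /= telescope_sumr// addrC subrK.
  by apply: is_cvgD => //; exact: is_cvg_cst.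
pose g x := limn (v ^~ x).
have cvg_v x : v ^~ x @ \oo --> g x.
  rewrite /g /v; have [Dx|nDx] := pselect (D x).
    rewrite indicE mem_set//=.
    under eq_fun do rewrite mulr1.
    exact: cv.
  rewrite indicE memNset//=.
  under eq_fun do rewrite mulr0.
  exact: is_cvg_cst.
exists g; split.
- apply: (measurable_fun_cvg (h := v)) => //.
- move=> n; apply: le_trans (is_ n).
  apply: ge0_le_integral => //.
  + by apply/measurable_EFinP; apply: measurableT_comp => //; apply: measurable_funB => //; apply: (measurable_fun_cvg (h := v)).
  + move=> x _; have [sn|] := ltP (s n x) +oo; last by rewrite leye_eq => /eqP ->; rewrite leey.
    have Dx : D x.
      rewrite /D /s /=; under eq_eseriesr do rewrite addn0.
      rewrite (nneseries_split 0%N n)//= add0n.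
      rewrite lte_add_pinfty//; first by rewrite sumEFin ltry.
      have w0 j : 0 <= `|u j x - u j.+1 x|%:E by rewrite lee_fin.
      by have <- : s n x = _ := nneseries_addn n w0.
    have sfin : s n x \is a fin_num.
      by rewrite ge0_fin_numE//; exact: nneseries_ge0.
    rewrite -(fineK sfin) lee_fin.
    have cg : (fun m => u n x - u (n + m)%N x)%R @ \oo --> (u n x - g x)%R.
      apply: cvgB; first exact: cvg_cst.
      have := cvg_v x; rewrite /v indicE mem_set//=.
      under eq_fun do rewrite mulr1.
      by rewrite -(cvg_shiftn n); under eq_fun do rewrite addnC.
    have ca : (fun m => `|u n x - u (n + m)%N x|%R) @ \oo --> `|u n x - g x|%R.
      exact: cvg_norm cg.
    rewrite -(cvg_lim _ ca)//.
    apply: limr_le; first by apply/cvg_ex; eexists; exact: ca.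
    by apply: nearW => m /=; rewrite -lee_fin fineK.
- move=> x ux; rewrite /g (_ : v ^~ x = cst 0%R) ?lim_cst//.
  by apply/funext => n; rewrite /v ux mul0r.
Qed.
End real_L1_complete.

(* Unlike measurableType, carrier may be empty. As for the library's measures,
   vol is also defined off msets, where its values are irrelevant. *)
Record measure_space (R : realType) := MeasureSpace {
  carrier :> Type;
  msets : set (set carrier);
  vol : set carrier -> \bar R;
  msets_sigma_algebra : sigma_algebra [set: carrier] msets;
  vol0 : vol set0 = 0%E;
  vol_ge0 : forall A, (0 <= vol A)%E;
  vol_sigma_additive : forall A : (set carrier)^nat,
    (forall n, msets (A n)) -> trivIset [set: nat] A ->
    (fun n => \sum_(0 <= i < n) vol (A i))%E @ \oo --> vol (\bigcup_n A n);
  vol_finite : (vol [set: carrier] < +oo)%E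
}.

Record embedding (R : realType) (Y X : measure_space R) := Embedding {
  emb_fun :> Y -> X;
  emb_inj : injective emb_fun;
  emb_msets : forall B : set Y, msets B <-> msets (emb_fun @` B);
  emb_vol : forall B : set Y, msets B -> vol B = vol (emb_fun @` B)
}.

Section mea_emb.
Context {R : realType}.
Implicit Types X Y Z : measure_space R.

Section id_comp.
Variables (Z Y X : measure_space R) (i : embedding Y X) (j : embedding Z Y).

Let id_msets (B : set X) : msets B <-> msets (id @` B).
Proof. by rewrite image_id. Qed.

Let id_vol (B : set X) : msets B -> vol B = vol (id @` B).
Proof. by rewrite image_id. Qed.

Definition emb_id : embedding X X := Embedding (@inj_id X) id_msets id_vol.

Let comp_msets (B : set Z) : msets B <-> msets ((i \o j) @` B).
Proof. by rewrite -image_comp (emb_msets j) (emb_msets i). Qed.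

Let comp_vol (B : set Z) : msets B -> vol B = vol ((i \o j) @` B).
Proof.
by move=> mB; rewrite -image_comp (emb_vol j)// (emb_vol i)// -(emb_msets j).
Qed.

Definition emb_comp : embedding Z X :=
  Embedding (inj_comp (@emb_inj _ _ _ i) (@emb_inj _ _ _ j)) comp_msets comp_vol.

End id_comp.

Definition complementary X Y Z (i : embedding Y X) (j : embedding Z X) :=
  range i `&` range j = set0 /\ range i `|` range j = [set: X].

Lemma emb_ext Y X (i j : embedding Y X) : i =1 j -> i = j.
Proof.
case: i j => [f p q r] [g p' q' r'] /= /funext fg.
by subst g; congr Embedding; exact: Prop_irrelevance.
Qed.

End mea_emb.

Section msets_theory.
Context {R : realType} (X : measure_space R).
Implicit Types A B : set X.

Lemma mset0 : @msets _ X set0.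
Proof. by have [] := msets_sigma_algebra X. Qed.

Lemma msetC A : msets A -> msets (~` A).
Proof. by have [_ h _] := msets_sigma_algebra X => /h; rewrite setTD. Qed.

Lemma mset_bigcup (A : (set X)^nat) :
  (forall n, msets (A n)) -> msets (\bigcup_n A n).
Proof. by have [_ _] := msets_sigma_algebra X; exact. Qed.

Lemma msetT : @msets _ X setT.
Proof. by rewrite -setC0; apply: msetC; exact: mset0. Qed.

Lemma msetU A B : msets A -> msets B -> msets (A `|` B).
Proof.
move=> mA mB; rewrite -bigcup2E; apply: mset_bigcup => -[//|[//|n]].
exact: mset0.
Qed.

Lemma msetI A B : msets A -> msets B -> msets (A `&` B).
Proof.
by move=> mA mB; rewrite -(setCK (A `&` B)) setCI; apply/msetC/msetU; exact: msetC.
Qed.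

End msets_theory.

(* The library integrates over measurableTypes, which are inhabited; to cover
   the empty space, X is integrated over with a null point None adjoined. *)
Definition adjoin (R : realType) (X : measure_space R) : Type := option X.

Section adjoin.
Context {R : realType} (X : measure_space R).

HB.instance Definition _ := gen_eqMixin (adjoin X).
HB.instance Definition _ := gen_choiceMixin (adjoin X).
HB.instance Definition _ := isPointed.Build (adjoin X) None.

Definition adjoin_msets : set (set (adjoin X)) :=
  [set A | msets (Some @^-1` A)].

Let adjoin_mset0 : adjoin_msets set0.
Proof. by rewrite /adjoin_msets/= preimage_set0; exact: mset0. Qed.

Let adjoin_msetC A : adjoin_msets A -> adjoin_msets (~` A).
Proof. exact: msetC. Qed.

Let adjoin_mset_bigcup (A : (set (adjoin X))^nat) :
  (forall n, adjoin_msets (A n)) -> adjoin_msets (\bigcup_n A n).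
Proof. by move=> mA; rewrite /adjoin_msets/= preimage_bigcup; exact: mset_bigcup. Qed.

HB.instance Definition _ := isMeasurable.Build default_measure_display
  (adjoin X) adjoin_mset0 adjoin_msetC adjoin_mset_bigcup.

Definition adjoin_vol (A : set (adjoin X)) : \bar R := vol (Some @^-1` A).

Let adjoin_vol0 : adjoin_vol set0 = 0%E.
Proof. by rewrite /adjoin_vol preimage_set0 vol0. Qed.

Let adjoin_vol_ge0 A : (0 <= adjoin_vol A)%E.
Proof. exact: vol_ge0. Qed.

Let adjoin_vol_semi_sigma_additive : semi_sigma_additive adjoin_vol.
Proof.
move=> A mA tA mUA; rewrite /adjoin_vol preimage_bigcup.
apply: vol_sigma_additive => // m n _ _ [x [/= Amx Anx]].
by apply: tA => //; exists (Some x).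
Qed.

HB.instance Definition _ := isMeasure.Build _ _ _ adjoin_vol
  adjoin_vol0 adjoin_vol_ge0 adjoin_vol_semi_sigma_additive.

Let adjoin_vol_finite : fin_num_fun adjoin_vol.
Proof.
move=> A mA; rewrite ge0_fin_numE; last exact: vol_ge0.
apply: (@le_lt_trans _ _ (adjoin_vol setT)); last exact: vol_finite.
by apply: le_measure; rewrite ?inE.
Qed.

HB.instance Definition _ :=
  Measure_isFinite.Build _ _ _ adjoin_vol adjoin_vol_finite.

Lemma measurable_adjoin (A : set (adjoin X)) :
  measurable A <-> msets (Some @^-1` A).
Proof. by []. Qed.

Lemma adjoin_measurable_fun d (T : measurableType d) (h : adjoin X -> T) :
  (forall B, measurable B -> msets [set x | B (h (Some x))]) ->
  measurable_fun [set: adjoin X] h.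
Proof. by move=> mh _ B mB; rewrite setTI; exact: mh. Qed.

End adjoin.
Arguments adjoin_vol {R} X.

Definition extend0 (R : realType) (X : measure_space R) (V : zmodType)
  (f : X -> V) : adjoin X -> V := fun x => if x is Some y then f y else 0.

Section ext0.
Context {R : realType} {Y X : measure_space R} (i : embedding Y X).

(* extension by zero along the embedding i *)
Definition ext0 (V : zmodType) (f : Y -> V) (x : X) : V :=
  if pselect (range i x) is left h then f (sval (cid2 h)) else 0.

Lemma ext0_emb (V : zmodType) (f : Y -> V) y : ext0 f (i y) = f y.
Proof.
rewrite /ext0; case: pselect => [h|[]]; last by exists y.
by case: cid2 => z /= _ /emb_inj ->.
Qed.

Lemma ext0_out (V : zmodType) (f : Y -> V) x : ~ range i x -> ext0 f x = 0.
Proof. by rewrite /ext0; case: pselect. Qed.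

Lemma ext0_map (V W : zmodType) (p : V -> W) (f : Y -> V) : p 0 = 0 ->
  forall x, p (ext0 f x) = ext0 (p \o f) x.
Proof. by move=> p0 x; rewrite /ext0; case: pselect. Qed.

Lemma range_emb_mset : msets (range i).
Proof. by rewrite -emb_msets; exact: msetT. Qed.

Definition adjoin_map (x : adjoin Y) : adjoin X := omap i x.

Lemma image_preimage_emb (B : set X) : i @` (i @^-1` B) = B `&` range i.
Proof.
apply/seteqP; split=> [_ [y /= By <-]|x [Bx [y _ yx]]]; first by split=> //; exists y.
by exists y => //=; rewrite yx.
Qed.

Lemma mset_emb_preimage (B : set X) : msets B -> msets (i @^-1` B).
Proof.
move=> mB; rewrite (emb_msets i) image_preimage_emb.
exact: (msetI mB range_emb_mset).
Qed.

Lemma measurable_adjoin_map : measurable_fun [set: adjoin Y] adjoin_map.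
Proof. by apply: adjoin_measurable_fun => B mB; exact: mset_emb_preimage mB. Qed.

Lemma vol_emb_preimage (B : set X) : msets B ->
  vol (i @^-1` B) = vol (B `&` range i).
Proof.
by move=> mB; rewrite (emb_vol i) ?image_preimage_emb//; exact: mset_emb_preimage.
Qed.

Lemma integral_emb (h : adjoin X -> \bar R) :
  measurable_fun [set: adjoin X] h -> (forall x, 0 <= h x)%E ->
  (forall x, ~ range i x -> h (Some x) = 0%E) ->
  (\int[adjoin_vol X]_x h x = \int[adjoin_vol Y]_y h (adjoin_map y))%E.
Proof.
move=> mh h0 hout.
pose D : set (adjoin X) := [set x | if x is Some x' then range i x' else True].
have mD : measurable D.
  by apply/measurable_adjoin; exact: range_emb_mset.
have hD : h \_ D = h.
  apply/funext => x; rewrite patchE; case: ifPn => //.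
  rewrite notin_setE; case: x => [x|]; last by case.
  by move=> /hout ->.
rewrite -{1}hD -integral_mkcond.
transitivity (\int[pushforward (adjoin_vol Y) adjoin_map]_(x in D) h x)%E.
  apply: eq_measure_integral => [|mmap A mA AD].
    exact: measurable_adjoin_map.
  rewrite /pushforward /= /adjoin_vol.
  transitivity (vol (i @^-1` (Some @^-1` A : set X))); last by [].
  rewrite vol_emb_preimage//; congr vol.
  by apply/seteqP; split=> [x Ax|x []//]; split=> //; exact: (AD _ Ax).
rewrite ge0_integral_pushforward//.
- rewrite (_ : _ @^-1` D = setT)//; apply/seteqP; split=> // -[y _|//].
  by exists y.
- exact: measurable_adjoin_map.
- exact: measurable_funS mh.
Qed.

Lemma ext0_preimage (V : zmodType) (f : Y -> V) (B : set V) :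
  ext0 f @^-1` B = i @` (f @^-1` B) `|` (~` range i `&` [set _ | B 0]).
Proof.
apply/seteqP; split=> [x /= Bx|x [[y /= By <-]|[/= nix B0]]] /=; last 2 first.
- by rewrite ext0_emb.
- by rewrite ext0_out.
have [[y _ yx]|nix] := pselect (range i x).
  by left; exists y => //; rewrite -yx ext0_emb in Bx.
by right; rewrite ext0_out in Bx.
Qed.

Lemma mset_ext0 (V : zmodType) (f : Y -> V) (B : set V) :
  msets (f @^-1` B) -> msets (ext0 f @^-1` B).
Proof.
move=> mf; rewrite ext0_preimage; apply: msetU.
  by rewrite -emb_msets.
apply: msetI; first by apply: msetC; exact: range_emb_mset.
have [B0|nB0] := pselect (B 0).
  by rewrite (_ : [set _ | _] = setT); [exact: msetT|apply/seteqP; split].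
by rewrite (_ : [set _ | _] = set0); [exact: mset0|apply/seteqP; split].
Qed.

End ext0.

Section integrable_functions.
Context (R : realType) (k : ground_field) (X : measure_space R).
Local Notation K := (scalar R k).
Local Notation mu := (adjoin_vol X).
Implicit Types f g : X -> K^o.

Definition integrable_fun f : Prop :=
  mu.-integrable [set: adjoin X] (EFin \o (@reS R k \o extend0 f)) /\
  mu.-integrable [set: adjoin X] (EFin \o (@imS R k \o extend0 f)).

Definition integral_fun f : K :=
  mkS k (\int[mu]_x reS (extend0 f x)) (\int[mu]_x imS (extend0 f x)).

Definition norm1_fun f : R := \int[mu]_x absS (extend0 f x).

(* f = 0 almost everywhere *)
Definition ae_zero f : Prop :=
  exists N : set X, [/\ msets N, vol N = 0%E & forall x, f x != 0 -> N x].

Definition integrable_pred : {pred X -> K^o} :=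
  fun f => `[< integrable_fun f >].

Lemma measurable_absS (h : adjoin X -> K) :
  measurable_fun [set: adjoin X] (@reS R k \o h) ->
  measurable_fun [set: adjoin X] (@imS R k \o h) ->
  measurable_fun [set: adjoin X] (@absS R k \o h).
Proof.
move=> mr mi.
rewrite (_ : _ \o _ = Num.sqrt \o (fun x => (reS (h x)) ^+ 2 + (imS (h x)) ^+ 2)); last first.
  by apply/funext => x /=; rewrite absSE.
apply: measurableT_comp.
  by apply: continuous_measurable_fun; exact: sqrt_continuous.
by apply: measurable_funD; apply: measurable_funX.
Qed.

Lemma integrable_fun_abs f : integrable_fun f ->
  mu.-integrable [set: adjoin X] (EFin \o (@absS R k \o extend0 f)).
Proof.
move=> [ir ii].
have /measurable_EFinP mr := measurable_int _ ir.
have /measurable_EFinP mi := measurable_int _ ii.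
apply: (@le_integrable _ _ _ mu _ measurableT _
  (fun x => `|(reS (extend0 f x))%:E| + `|(imS (extend0 f x))%:E|)%E).
- by apply/measurable_EFinP; exact: measurable_absS.
- move=> x _ /=; rewrite lee_fin ger0_norm ?absS_ge0//.
  by rewrite [leRHS]ger0_norm ?addr_ge0// -{1}(mkS_re_im (extend0 f x)) absS_mkS.
- by apply: integrableD => //; exact: integrable_abse.
Qed.

Lemma integrable_funP f :
  measurable_fun [set: adjoin X] (@reS R k \o extend0 f) ->
  measurable_fun [set: adjoin X] (@imS R k \o extend0 f) ->
  (\int[mu]_x (absS (extend0 f x))%:E < +oo)%E -> integrable_fun f.
Proof.
move=> mr mi fi.
have ia : mu.-integrable [set: adjoin X] (EFin \o (@absS R k \o extend0 f)).
  apply/integrableP; split; first by apply/measurable_EFinP; exact: measurable_absS.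
  by under eq_integral do rewrite /= ger0_norm ?absS_ge0//.
split; apply: le_integrable ia => //; try exact/measurable_EFinP.
- by move=> x _ /=; rewrite lee_fin [leRHS]ger0_norm ?absS_ge0// absS_re.
- by move=> x _ /=; rewrite lee_fin [leRHS]ger0_norm ?absS_ge0// absS_im.
Qed.

Lemma norm1_funE f : integrable_fun f ->
  (norm1_fun f)%:E = (\int[mu]_x (absS (extend0 f x))%:E)%E.
Proof.
move=> /integrable_fun_abs fi; rewrite /norm1_fun /Rintegral fineK//.
exact: integrable_fin_num fi.
Qed.

Lemma extend0D f g x : extend0 (f + g) x = extend0 f x + extend0 g x.
Proof. by case: x => [x|] /=; rewrite ?addr0. Qed.

Lemma extend0B f g x : extend0 (f - g) x = extend0 f x - extend0 g x.
Proof. by case: x => [x|] /=; rewrite ?subr0. Qed.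

Lemma extend0Z (c : K) f x : extend0 (c *: f) x = c * extend0 f x.
Proof. by case: x => [x|] /=; rewrite ?mulr0. Qed.

Lemma integrable_fun_submod : submod_closed integrable_pred.
Proof.
split.
  apply/asboolP; split; apply: (eq_integrable _ (cst 0%E)) => //.
  - by move=> [x|] _ /=; rewrite reS0.
  - exact: integrable0.
  - by move=> [x|] _ /=; rewrite imS0.
  - exact: integrable0.
move=> c f g /asboolP [fr fi] /asboolP [gr gi]; apply/asboolP; split.
- apply: (eq_integrable _ (((fun x => (reS c)%:E * (reS (extend0 f x))%:E) \-
    (fun x => (imS c)%:E * (imS (extend0 f x))%:E)) \+
    (fun x => (reS (extend0 g x))%:E))%E) => //.
    move=> x _ /=; rewrite extend0D extend0Z reSD reSM -!EFinM -EFinB -EFinD//.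
  apply: integrableD => //; apply: integrableB => //; exact: integrableZl.
- apply: (eq_integrable _ (((fun x => (reS c)%:E * (imS (extend0 f x))%:E) \+
    (fun x => (imS c)%:E * (reS (extend0 f x))%:E)) \+
    (fun x => (imS (extend0 g x))%:E))%E) => //.
    move=> x _ /=; rewrite extend0D extend0Z imSD imSM -!EFinM -!EFinD//.
  apply: integrableD => //; apply: integrableD => //; exact: integrableZl.
Qed.

HB.instance Definition _ := GRing.isSubmodClosed.Build _ _ integrable_pred
  integrable_fun_submod.

Record L1_fun := L1Fun { L1_val :> X -> K^o; _ : L1_val \in integrable_pred }.

HB.instance Definition _ := [isSub for L1_val].
HB.instance Definition _ := [Choice of L1_fun by <:].
HB.instance Definition _ := [SubChoice_isSubLmodule of L1_fun by <:].

Lemma L1_funP (f : L1_fun) : integrable_fun f.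
Proof. by case: f => f /= /asboolP. Qed.

Definition L1_null : {pred L1_fun} := fun u => `[< ae_zero u >].

Lemma L1_null_submod : submod_closed L1_null.
Proof.
split.
  apply/asboolP; exists set0; split; [exact: mset0|exact: vol0|].
  by move=> x; rewrite eqxx.
move=> c f g /asboolP [M [mM M0 fM]] /asboolP [N [mN N0 gN]].
apply/asboolP; exists (M `|` N); split.
- exact: msetU.
- apply/eqP; rewrite eq_le vol_ge0 andbT.
  have h (A : set X) : vol A = mu (Some @` A).
    congr vol; apply/seteqP; split=> [x Ax|x [y Ay [<-]]//]; by exists x.
  have mh (A : set X) : msets A -> measurable (Some @` A : set (adjoin X)).
    move=> mA; apply/measurable_adjoin.
    rewrite (_ : _ @^-1` _ = A)//.
    by apply/seteqP; split=> [x [y Ay [<-]]//|x Ax]; exists x.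
  rewrite h image_setU; apply: le_trans.
    exact: (@measureU2 _ _ _ mu _ _ (mh _ mM) (mh _ mN)).
  rewrite -[leRHS]adde0; apply: leeD.
  + by move: M0; rewrite h => /eqP; rewrite eq_le => /andP[].
  + by move: N0; rewrite h => /eqP; rewrite eq_le => /andP[].
- move=> x /= fgx; have [fx|fx] := eqVneq (f x) 0; last by left; exact: fM.
  right; apply: gN; apply: contra_neq fgx => gx.
  by transitivity (c * f x + g x) => //; rewrite fx gx mulr0 addr0.
Qed.

HB.instance Definition _ := GRing.isSubmodClosed.Build _ _ L1_null
  L1_null_submod.

Definition L1 : Type := Quotient.quot L1_null.

HB.instance Definition _ := GRing.Zmodule.on L1.
HB.instance Definition _ := EqQuotient.on L1.

Definition L1_class (f : L1_fun) : L1 := \pi_L1 f.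

End integrable_functions.

Section L1_lmodule.
Context (R : realType) (k : ground_field) (X : measure_space R).
Local Notation K := (scalar R k).
Local Notation mu := (adjoin_vol X).
Local Notation L1_fun := (L1_fun k X).
Local Notation L1 := (L1 k X).
Implicit Types (f g : L1_fun) (c : K) (u v : L1).

Lemma L1_classP f g : L1_class f = L1_class g <-> ae_zero (f - g : L1_fun).
Proof.
have -> : (ae_zero (f - g : L1_fun)) = (f - g \in @L1_null R k X).
  by rewrite unfold_in /L1_null asboolE.
rewrite Quotient.idealrBE; split=> [/eqP//|/eqP//].
Qed.

Lemma L1_ind (P : L1 -> Prop) : (forall f, P (L1_class f)) -> forall u, P u.
Proof. by move=> Pf u; rewrite -[u]reprK; exact: Pf. Qed.

Lemma L1_classD f g : L1_class (f + g) = L1_class f + L1_class g.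
Proof. by rewrite /L1_class !piE. Qed.

Lemma L1_classN f : L1_class (- f) = - L1_class f.
Proof. by rewrite /L1_class !piE. Qed.

Lemma L1_class0 : L1_class (0 : L1_fun) = 0.
Proof. by rewrite /L1_class !piE. Qed.

Definition L1_scale c u : L1 := L1_class (c *: repr u).

Lemma L1_classZ c f : L1_class (c *: f) = L1_scale c (L1_class f).
Proof.
apply/L1_classP; rewrite -scalerBr.
have : L1_class f = L1_class (repr (L1_class f)) by rewrite {2}/L1_class reprK.
move=> /L1_classP/asboolP h; apply/asboolP.
exact: (@rpredZ _ _ (@L1_null R k X) c _ h).
Qed.

Let L1_scalerA a b u : L1_scale a (L1_scale b u) = L1_scale (a * b) u.
Proof. by elim/L1_ind: u => f; rewrite -!L1_classZ scalerA. Qed.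

Let L1_scale1r : left_id 1 L1_scale.
Proof. by elim/L1_ind => f; rewrite -L1_classZ scale1r. Qed.

Let L1_scalerDr : right_distributive L1_scale +%R.
Proof.
move=> c; elim/L1_ind => f; elim/L1_ind => g.
by rewrite -L1_classD -!L1_classZ scalerDr L1_classD.
Qed.

Let L1_scalerDl u : {morph L1_scale^~ u : a b / a + b}.
Proof.
by move=> a b; elim/L1_ind: u => f; rewrite -!L1_classZ scalerDl L1_classD.
Qed.

HB.instance Definition _ := GRing.Zmodule_isLmodule.Build K L1
  L1_scalerA L1_scale1r L1_scalerDr L1_scalerDl.

(* the L1 norm, as an element of K *)
Definition L1_norm u : K := ofR k (norm1_fun (repr u)).

Lemma ae_null f g (p : K -> R) : p 0 = 0 -> ae_zero (f - g : L1_fun) ->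
  ae_eq mu [set: adjoin X] (EFin \o (p \o extend0 f)) (EFin \o (p \o extend0 g)).
Proof.
move=> p0 [N [mN N0 fgN]]; exists (Some @` N : set (adjoin X)).
have e : Some @^-1` (Some @` N) = N.
  by apply/seteqP; split=> [x [y Ay [<-]]//|x Ax]; exists x.
split.
- by apply/measurable_adjoin; rewrite e.
- by rewrite /= /adjoin_vol e.
- move=> [x|] /= h; last by exfalso; apply: h => _ /=.
  exists x => //; apply: fgN; apply/eqP => fg; apply: h => _.
  by congr ((p _)%:E); apply/eqP; rewrite -subr_eq0; apply/eqP.
Qed.

Lemma norm1_fun_ge0 (f : X -> K^o) : 0 <= norm1_fun f.
Proof. by apply: Rintegral_ge0 => // x _; exact: absS_ge0. Qed.

Lemma norm1_fun_class f g : L1_class f = L1_class g -> norm1_fun f = norm1_fun g.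
Proof.
move=> /L1_classP /(@ae_null f g (@absS R k)) => /(_ absS0) fg.
congr fine; apply: ae_eq_integral => //.
- by have /measurable_int := integrable_fun_abs (L1_funP f).
- by have /measurable_int := integrable_fun_abs (L1_funP g).
Qed.

Lemma L1_normE f : L1_norm (L1_class f) = ofR k (norm1_fun f).
Proof. by congr ofR; apply: norm1_fun_class; rewrite {1}/L1_class reprK. Qed.

Lemma integral_fun_class f g :
  L1_class f = L1_class g -> integral_fun f = integral_fun g.
Proof.
move=> /L1_classP fg; have [fr fi] := L1_funP f; have [gr gi] := L1_funP g.
congr mkS; congr fine; apply: ae_eq_integral => //.
- exact: measurable_int fr.
- exact: measurable_int gr.
- by apply: ae_null => //; exact: reS0.
- exact: measurable_int fi.
- exact: measurable_int gi.
- by apply: ae_null => //; exact: imS0.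
Qed.

Let L1_normD u v : L1_norm (u + v) <= L1_norm u + L1_norm v.
Proof.
elim/L1_ind: u => f; elim/L1_ind: v => g.
rewrite -L1_classD !L1_normE -ofRD ler_ofR -lee_fin EFinD.
rewrite !norm1_funE//; [|exact: L1_funP..].
rewrite -ge0_integralD//.
- apply: ge0_le_integral => //.
  + by move=> x _; rewrite lee_fin absS_ge0.
  + by have /measurable_int := integrable_fun_abs (L1_funP (f + g)).
  + apply: emeasurable_funD.
    * by have /measurable_int := integrable_fun_abs (L1_funP f).
    * by have /measurable_int := integrable_fun_abs (L1_funP g).
  + by move=> x _; rewrite -EFinD lee_fin (extend0D f g) absSD.
- by move=> x _; rewrite lee_fin absS_ge0.
- by have /measurable_int := integrable_fun_abs (L1_funP f).
- by move=> x _; rewrite lee_fin absS_ge0.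
- by have /measurable_int := integrable_fun_abs (L1_funP g).
Qed.

Let L1_normZ c u : L1_norm (c *: u) = `|c| * L1_norm u.
Proof.
elim/L1_ind: u => f; rewrite -[c *: _]/(L1_scale _ _) -L1_classZ !L1_normE.
rewrite normS -ofRM; congr ofR; rewrite -RintegralZl//; last exact: integrable_fun_abs (L1_funP f).
by apply: eq_Rintegral => x _; rewrite (extend0Z c f) absSM.
Qed.

Let L1_norm_eq0 u : L1_norm u = 0 -> u = 0.
Proof.
elim/L1_ind: u => f; rewrite L1_normE -(@ofR0 R k) => /ofR_inj f0.
have := norm1_funE (L1_funP f); rewrite f0 => /esym f0'.
have mabs : measurable_fun [set: adjoin X] (EFin \o (@absS R k \o extend0 f)).
  by have /measurable_int := integrable_fun_abs (L1_funP f).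
have := ae_eq_integral_abs mu measurableT mabs.
have -> : (\int[mu]_x `|(EFin \o (@absS R k \o extend0 f)) x| = 0)%E.
  by apply: etrans f0'; apply: eq_integral => x _ /=; rewrite ger0_norm// absS_ge0.
move=> [/(_ erefl) + _] => -[N [mN N0 fN]].
rewrite -L1_class0; apply/L1_classP; rewrite subr0.
exists (Some @^-1` N); split => // x fx; apply: fN => /= /(_ Logic.I) [] /absS_eq0 fx0.
by rewrite fx0 eqxx in fx.
Qed.

HB.instance Definition _ :=
  Lmodule_isNormed.Build K L1 L1_normD L1_normZ L1_norm_eq0.

Lemma L1_normrE f : `|L1_class f| = ofR k (norm1_fun f).
Proof. exact: L1_normE. Qed.

Lemma norm1_mkS (f : L1_fun) : norm1_fun f <=
  \int[mu]_x `|reS (extend0 f x)| + \int[mu]_x `|imS (extend0 f x)|.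
Proof.
have [fr fi] := L1_funP f.
rewrite -RintegralD//; [|exact: integrable_norm fr|exact: integrable_norm fi].
apply: le_Rintegral => //.
- exact: integrable_fun_abs (L1_funP f).
- by apply: (eq_integrable measurableT _ _ _ (integrableD measurableT (integrable_norm fr) (integrable_norm fi))).
- by move=> x _; rewrite -{1}(mkS_re_im (extend0 f x)) absS_mkS.
Qed.

End L1_lmodule.

Section L1_complete.
Context (R : realType) (k : ground_field) (X : measure_space R).
Local Notation K := (scalar R k).
Local Notation mu := (adjoin_vol X).
Local Notation L1_fun := (L1_fun k X).
Local Notation L1 := (L1 k X).

Lemma L1_seq_complete (f : nat -> L1_fun) :
  (forall n, norm1_fun (f n - f n.+1 : L1_fun) <= 2 * 2^-1 ^+ n) ->
  exists g : L1_fun, forall n, norm1_fun (f n - g : L1_fun) <= 8 * 2^-1 ^+ n.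
Proof.
move=> df.
have part (p : K -> R) : (forall z w, p (z - w) = p z - p w) -> p 0 = 0 ->
    (forall z, `|p z| <= absS z) ->
    (forall h : L1_fun, mu.-integrable [set: adjoin X] (EFin \o (p \o extend0 h))) ->
    exists g : adjoin X -> R, [/\ measurable_fun [set: adjoin X] g,
      forall n, (\int[mu]_x `|p (extend0 (f n) x) - g x|%:E <= (4 * 2^-1 ^+ n)%:E)%E &
      forall x, (forall n, p (extend0 (f n) x) = 0) -> g x = 0].
  move=> pB p0 plip pint.
  apply: (@real_L1_complete _ (adjoin X) R mu (fun n => p \o extend0 (f n))).
    by move=> n; apply/measurable_EFinP; exact: measurable_int (pint (f n)).
  move=> n; apply: (@le_trans _ _ (norm1_fun (f n - f n.+1 : L1_fun))%:E).
    rewrite norm1_funE; last exact: L1_funP.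
    apply: ge0_le_integral => //.
    - apply/measurable_EFinP; apply: measurableT_comp => //.
      by apply: measurable_funB; apply/measurable_EFinP;
        [exact: measurable_int (pint (f n))|exact: measurable_int (pint (f n.+1))].
    - by have /measurable_int := integrable_fun_abs (L1_funP (f n - f n.+1)).
    - by move=> x _; rewrite lee_fin (extend0B (f n) (f n.+1)) -pB plip.
  by rewrite lee_fin.
have [a [ma fa a0]] := part _ reSB reS0 absS_re (fun h => (L1_funP h).1).
have [b [mb fb b0]] := part _ imSB imS0 absS_im (fun h => (L1_funP h).2).
pose g0 : X -> K^o := fun x => mkS k (a (Some x)) (b (Some x)).
have aN : a None = 0 by apply: a0 => n /=; exact: reS0.
have bN : b None = 0 by apply: b0 => n /=; exact: imS0.
have gE x : extend0 g0 x = mkS k (a x) (b x).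
  by case: x => //=; rewrite aN bN -/(ofR k 0) ofR0.
have reg : @reS R k \o extend0 g0 = a.
  by apply/funext => x /=; rewrite gE reS_mkS.
have img : @imS R k \o extend0 g0 = b.
  apply/funext => x /=; rewrite gE.
  have [//|[kR ->]] := @imS_mkS R k (a x) (b x).
  by rewrite b0// => n; move: (extend0 _ _); rewrite kR.
have dom x n : absS (extend0 (f n) x - extend0 g0 x) <=
    `|reS (extend0 (f n) x) - a x| + `|imS (extend0 (f n) x) - b x|.
  by rewrite gE -{1}(mkS_re_im (extend0 (f n) x)) -mkSB absS_mkS.
have mfa n : measurable_fun [set: adjoin X]
    (fun x => `|reS (extend0 (f n) x) - a x|).
  apply: measurableT_comp => //; apply: measurable_funB => //.
  by apply/measurable_EFinP; exact: measurable_int (L1_funP (f n)).1.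
have mfb n : measurable_fun [set: adjoin X]
    (fun x => `|imS (extend0 (f n) x) - b x|).
  apply: measurableT_comp => //; apply: measurable_funB => //.
  by apply/measurable_EFinP; exact: measurable_int (L1_funP (f n)).2.
have mabs n : measurable_fun [set: adjoin X]
    (@absS R k \o (fun x => extend0 (f n) x - extend0 g0 x)).
  apply: measurable_absS.
    rewrite (_ : _ \o _ = (@reS R k \o extend0 (f n)) \- a).
      apply: measurable_funB => //.
      by apply/measurable_EFinP; exact: measurable_int (L1_funP (f n)).1.
    by apply/funext => x /=; rewrite reSB -reg.
  rewrite (_ : _ \o _ = (@imS R k \o extend0 (f n)) \- b).
    apply: measurable_funB => //.
    by apply/measurable_EFinP; exact: measurable_int (L1_funP (f n)).2.
  by apply/funext => x /=; rewrite imSB -img.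
have bound n : (\int[mu]_x (absS (extend0 (f n) x - extend0 g0 x))%:E <=
    (8 * 2^-1 ^+ n)%:E)%E.
  apply: (@le_trans _ _ (\int[mu]_x (`|reS (extend0 (f n) x) - a x|%:E +
      `|imS (extend0 (f n) x) - b x|%:E))%E).
    apply: ge0_le_integral => //.
    - by move=> x _; rewrite lee_fin absS_ge0.
    - by apply/measurable_EFinP; exact: mabs.
    - by apply: emeasurable_funD; apply/measurable_EFinP.
    - by move=> x _; rewrite -EFinD lee_fin.
  rewrite ge0_integralD//; [|exact/measurable_EFinP..].
  apply: (le_trans (leeD (fa n) (fb n))).
  by rewrite -EFinD lee_fin -mulrDl -natrD.
have ig0 : integrable_fun g0.
  apply: integrable_funP; rewrite ?reg ?img//.
  apply: (@le_lt_trans _ _ (\int[mu]_x ((absS (extend0 (f 0%N) x))%:E +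
    (absS (extend0 (f 0%N) x - extend0 g0 x))%:E))%E).
    apply: ge0_le_integral => //.
    - by move=> x _; rewrite lee_fin absS_ge0.
    - by apply/measurable_EFinP; apply: measurable_absS; rewrite ?reg ?img.
    - apply: emeasurable_funD; last by apply/measurable_EFinP; exact: mabs.
      by have /measurable_int := integrable_fun_abs (L1_funP (f 0%N)).
    - move=> x _; rewrite -EFinD lee_fin -(absSN (_ - _)).
      by apply: le_trans (absSD _ _); rewrite opprB addrC subrK.
  rewrite ge0_integralD//.
  - rewrite lte_add_pinfty//.
      by rewrite -norm1_funE ?ltry//; exact: L1_funP.
    by apply: (le_lt_trans (bound 0%N)); rewrite ltry.
  - by move=> x _; rewrite lee_fin absS_ge0.
  - by have /measurable_int := integrable_fun_abs (L1_funP (f 0%N)).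
  - by move=> x _; rewrite lee_fin absS_ge0.
  - by apply/measurable_EFinP; exact: mabs.
have ig : g0 \in @integrable_pred R k X by apply/asboolP.
exists (L1Fun ig) => n; rewrite -lee_fin norm1_funE; last exact: L1_funP.
apply: le_trans (bound n); rewrite le_eqVlt; apply/orP; left; apply/eqP.
by apply: eq_integral => x _; rewrite (extend0B (f n) g0).
Qed.

Lemma L1_complete (F : set_system L1) : ProperFilter F -> cauchy F -> cvg F.
Proof.
move=> FF /cauchyP Fc.
pose r n : R := 2^-1 ^+ n.
have e0 n : 0 < ofR k (r n) by rewrite -(@ofR0 R k) ltr_ofR exprn_gt0.
have /choice [x xP] : forall n, exists x : L1, F (ball x (ofR k (r n))).
  by move=> n; exact: Fc.
pose f n : L1_fun := repr (x n).
have fx n : L1_class (f n) = x n by rewrite /L1_class reprK.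
have ltb n y : ball (x n) (ofR k (r n)) y -> `|x n - y| < ofR k (r n).
  by rewrite -ball_normE.
have df n : norm1_fun (f n - f n.+1 : L1_fun) <= 2 * 2^-1 ^+ n.
  rewrite -(@ler_ofR R k) -L1_normrE L1_classD L1_classN !fx.
  have [y [/ltb yn /ltb ynn]] : ball (x n) (ofR k (r n)) `&`
      ball (x n.+1) (ofR k (r n.+1)) !=set0.
    exact: (filter_ex (filterI (xP n) (xP n.+1))).
  apply: (le_trans (ler_distD y _ _)).
  rewrite [X in ofR k X](_ : _ = r n + r n); last by rewrite mulr_natl mulr2n.
  rewrite ofRD; apply: lerD; first exact: ltW.
  rewrite distrC; apply: (le_trans (ltW ynn)); rewrite ler_ofR /r exprS ler_piMl ?exprn_ge0//.
  by rewrite invf_le1// ler1n.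
have [g fg] := L1_seq_complete df.
apply/cvg_ex; exists (L1_class g); apply/cvgrPdist_lt => e e_gt0.
have eE := ge0_scalar (ltW e_gt0).
have re0 : 0 < reS e by rewrite -(@ltr_ofR R k) -eE ofR0.
have [n ne] : exists n : nat, 9 * 2^-1 ^+ n < reS e.
  have /cvgrPdist_lt/(_ _ (divr_gt0 re0 (ltr0n R 9 : 0 < 9))) [n _ /(_ n (leqnn _))] :
      (fun n => 2^-1 ^+ n : R) @ \oo --> (0 : R).
    by apply: cvg_expr; rewrite ger0_norm// invf_lt1// ltr1n.
  rewrite /= sub0r normrN ger0_norm ?exprn_ge0// ltr_pdivlMr// mulrC => ?.
  by exists n.
apply: filterS (xP n) => y /ltb xy.
rewrite distrC (le_lt_trans (ler_distD (x n) _ _))// distrC.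
apply: (@lt_trans _ _ (ofR k (9 * 2^-1 ^+ n))); last by rewrite eE ltr_ofR.
have -> : 9 = 1 + 8 :> R by rewrite -[RHS](natrD _ 1 8).
rewrite mulrDl mul1r ofRD ltr_leD//.
rewrite -fx -L1_classN -L1_classD L1_normrE ler_ofR; exact: fg.
Qed.

HB.instance Definition _ := Uniform_isComplete.Build L1 L1_complete.

End L1_complete.

Section L1_functoriality.
Context {R : realType} {k : ground_field}.
Local Notation K := (scalar R k).
Local Notation L1_fun := (L1_fun k).
Local Notation L1 := (L1 k).
Implicit Types X Y Z : measure_space R.

Lemma extend0_ext0 Y X (i : embedding Y X) (f : Y -> K^o) y :
  extend0 (ext0 i f) (adjoin_map i y) = extend0 f y.
Proof. by case: y => //= y; rewrite ext0_emb. Qed.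

Lemma measurable_ext0 Y X (i : embedding Y X) (f : Y -> K^o) (p : K -> R) :
  p 0 = 0 -> measurable_fun [set: adjoin Y] (p \o extend0 f) ->
  measurable_fun [set: adjoin X] (p \o extend0 (ext0 i f)).
Proof.
move=> p0 mf; apply: adjoin_measurable_fun => B mB.
rewrite (_ : [set _ | _] = ext0 i (p \o f) @^-1` B); last first.
  by apply/seteqP; split=> x /=; rewrite (ext0_map i f p0).
by apply: mset_ext0; have := mf measurableT _ mB; rewrite setTI.
Qed.

Lemma integral_absS_ext0 Y X (i : embedding Y X) (f : L1_fun Y) :
  (\int[adjoin_vol X]_x (absS (extend0 (ext0 i f) x))%:E =
   \int[adjoin_vol Y]_x (absS (extend0 f x))%:E)%E.
Proof.
rewrite (integral_emb (i := i)).
- by apply: eq_integral => y _; rewrite extend0_ext0.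
- apply/measurable_EFinP; apply: measurable_ext0; first exact: absS0.
  by apply/measurable_EFinP; have /measurable_int := integrable_fun_abs (L1_funP f).
- by move=> x; rewrite lee_fin absS_ge0.
- by move=> x nix /=; rewrite ext0_out// absS0.
Qed.

Lemma integrable_ext0 Y X (i : embedding Y X) (f : L1_fun Y) :
  (ext0 i f : X -> K^o) \in @integrable_pred R k X.
Proof.
apply/asboolP; have [fr fi] := L1_funP f.
apply: integrable_funP.
- apply: measurable_ext0; first exact: reS0.
  by apply/measurable_EFinP; exact: measurable_int fr.
- apply: measurable_ext0; first exact: imS0.
  by apply/measurable_EFinP; exact: measurable_int fi.
- rewrite integral_absS_ext0 -norm1_funE ?ltry//; exact: L1_funP.
Qed.

Definition L1_fun_ext0 Y X (i : embedding Y X) (f : L1_fun Y) : L1_fun X :=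
  L1Fun (integrable_ext0 i f).

Lemma L1_fun_eqP X (f g : L1_fun X) : f =1 g -> f = g.
Proof. by move=> /funext fg; exact: val_inj. Qed.

Lemma ext0_linear Y X (i : embedding Y X) : linear (L1_fun_ext0 i).
Proof.
move=> c f g; apply: L1_fun_eqP => x.
transitivity (c * ext0 i f x + ext0 i g x); last by [].
rewrite /= /ext0; case: pselect => // h; first by rewrite mulr0 addr0.
Qed.

Definition L1_ext Y X (i : embedding Y X) (u : L1 Y) : L1 X :=
  L1_class (L1_fun_ext0 i (repr u)).

Lemma L1_extE Y X (i : embedding Y X) (f : L1_fun Y) :
  L1_ext i (L1_class f) = L1_class (L1_fun_ext0 i f).
Proof.
have : L1_class (repr (L1_class f)) = L1_class f by rewrite /L1_class reprK.
move=> /L1_classP [N [mN N0 fN]]; apply/L1_classP.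
exists (i @` N); split; first by rewrite -emb_msets.
  by rewrite -emb_vol.
move=> x; set g := repr _ in fN *.
have -> : (L1_fun_ext0 i g - L1_fun_ext0 i f) x = ext0 i g x - ext0 i f x by [].
have [[y _ <-]|nix] := pselect (range i x); last first.
  by rewrite !ext0_out// subrr eqxx.
by rewrite !ext0_emb => gf; exists y => //; exact: fN.
Qed.

Lemma L1_ext_linear Y X (i : embedding Y X) : linear (@L1_ext Y X i).
Proof.
move=> c; elim/L1_ind => f; elim/L1_ind => g.
have scE Z (h : L1_fun Z) : c *: L1_class h = L1_class (c *: h).
  by rewrite L1_classZ.
by rewrite scE -L1_classD !L1_extE ext0_linear L1_classD scE.
Qed.

Lemma L1_ext_norm Y X (i : embedding Y X) u : `|L1_ext i u| <= `|u|.
Proof.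
rewrite le_eqVlt; apply/orP; left; apply/eqP; elim/L1_ind: u => f.
rewrite L1_extE !L1_normrE; congr ofR; congr fine.
exact: integral_absS_ext0.
Qed.

End L1_functoriality.

(* Norms are valued in K: over the complex numbers <= compares elements with
   equal imaginary parts, here 0. *)
Record contraction (K : numFieldType) (V W : completeNormedModType K) :=
  Contraction {
    contr_fun :> V -> W;
    contr_linear : linear contr_fun;
    contr_norm : forall v, `|contr_fun v| <= `|v|
  }.

Record mea_functor (R : realType) (k : ground_field) := MeaFunctor {
  fobj :> measure_space R -> completeNormedModType (scalar R k);
  fmap : forall Y X, embedding Y X -> contraction (fobj Y) (fobj X);
  fmap_id : forall X (v : fobj X), fmap (emb_id X) v = v;
  fmap_comp : forall X Y Z (i : embedding Y X) (j : embedding Z Y) (v : fobj Z),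
    fmap (emb_comp i j) v = fmap i (fmap j v)
}.
Arguments fmap {R k} m {Y X} i.

Record B1_object (R : realType) (k : ground_field) := B1Object {
  B1_functor :> mea_functor R k;
  B1_elt : forall X, B1_functor X;
  B1_additive : forall X Y Z (i : embedding Y X) (j : embedding Z X),
    complementary i j ->
    fmap B1_functor i (B1_elt Y) + fmap B1_functor j (B1_elt Z) = B1_elt X;
  B1_bounded : forall X : measure_space R,
    `|B1_elt X| <= ofR k (fine (vol [set: X]));
  B1_triangle : forall X Y Z (i : embedding Y X) (j : embedding Z X),
    complementary i j -> forall (u : B1_functor Y) (w : B1_functor Z),
    `|fmap B1_functor i u + fmap B1_functor j w| <= `|u| + `|w|
}.

Record B1_map (R : realType) (k : ground_field) (F' F : B1_object R k) :=
  B1Map {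
  B1_comp :> forall X, contraction (F' X) (F X);
  B1_natural : forall Y X (i : embedding Y X) (u : F' Y),
    B1_comp X (fmap F' i u) = fmap F i (B1_comp Y u);
  B1_preserves : forall X, B1_comp X (B1_elt F' X) = B1_elt F X
}.

Section L1_B1.
Context (R : realType) (k : ground_field).
Local Notation K := (scalar R k).
Implicit Types X Y Z : measure_space R.

Definition L1_fmap Y X (i : embedding Y X) : contraction (L1 k Y) (L1 k X) :=
  Contraction (L1_ext_linear i) (L1_ext_norm i).

Let L1_fmap_id X (u : L1 k X) : L1_fmap (emb_id X) u = u.
Proof.
elim/L1_ind: u => f; rewrite /= L1_extE; congr L1_class.
by apply: L1_fun_eqP => x /=; rewrite -[x in ext0 _ _ x]/(emb_id X x) ext0_emb.
Qed.

Let L1_fmap_comp X Y Z (i : embedding Y X) (j : embedding Z Y) (u : L1 k Z) :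
  L1_fmap (emb_comp i j) u = L1_fmap i (L1_fmap j u).
Proof.
elim/L1_ind: u => f; rewrite /= !L1_extE; congr L1_class.
apply: L1_fun_eqP => x /=.
have [[y _ <-]|nix] := pselect (range i x); last first.
  rewrite [RHS]ext0_out// ext0_out// => -[z _ zx]; apply: nix.
  by exists (j z).
rewrite ext0_emb; have [[z _ <-]|njy] := pselect (range j y).
  by rewrite ext0_emb -[i (j z)]/(emb_comp i j z) ext0_emb.
rewrite [RHS]ext0_out// ext0_out// => -[z _ zy]; apply: njy.
by exists z => //; exact: (@emb_inj _ _ _ i).
Qed.

Definition L1_functor : mea_functor R k := MeaFunctor L1_fmap_id L1_fmap_comp.

Lemma integrable_cst1 X : (fun=> 1 : K^o) \in @integrable_pred R k X.
Proof.
apply/asboolP; apply: integrable_funP.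
- apply: adjoin_measurable_fun => B mB /=; rewrite reS1.
  have [B1|nB1] := pselect (B 1).
    by rewrite (_ : [set _ | _] = setT); [exact: msetT|apply/seteqP; split].
  by rewrite (_ : [set _ | _] = set0); [exact: mset0|apply/seteqP; split].
- apply: adjoin_measurable_fun => B mB /=; rewrite imS1.
  have [B1|nB1] := pselect (B 0).
    by rewrite (_ : [set _ | _] = setT); [exact: msetT|apply/seteqP; split].
  by rewrite (_ : [set _ | _] = set0); [exact: mset0|apply/seteqP; split].
- apply: (@le_lt_trans _ _ (\int[adjoin_vol X]_x (cst 1 x))%E).
    apply: ge0_le_integral => //.
    + by move=> x _; rewrite lee_fin absS_ge0.
    + apply: adjoin_measurable_fun => B mB /=; rewrite absS1.
      have [B1|nB1] := pselect (B 1%:E).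
        by rewrite (_ : [set _ | _] = setT); [exact: msetT|apply/seteqP; split].
      by rewrite (_ : [set _ | _] = set0); [exact: mset0|apply/seteqP; split].
    + by move=> [x|] _ /=; rewrite lee_fin ?absS1// absS0.
  rewrite integral_cst// mul1e; exact: vol_finite.
Qed.

Definition L1_one X : L1 k X := L1_class (L1Fun (integrable_cst1 X)).

Let L1_one_additive X Y Z (i : embedding Y X) (j : embedding Z X) :
  complementary i j ->
  fmap L1_functor i (L1_one Y) + fmap L1_functor j (L1_one Z) = L1_one X.
Proof.
move=> [ij0 ijT]; rewrite /= !L1_extE -L1_classD; congr L1_class.
apply: L1_fun_eqP => x.
transitivity (ext0 i (fun=> 1 : K^o) x + ext0 j (fun=> 1 : K^o) x); first by [].
have : (range i `|` range j) x by rewrite ijT.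
have ij0x : ~ (range i `&` range j) x by rewrite ij0.
move=> [ix|jx].
- rewrite (@ext0_out _ _ _ j) ?addr0; last by move=> jx; apply: ij0x; split.
  by case: ix => y _ <-; rewrite ext0_emb.
- rewrite (@ext0_out _ _ _ i) ?add0r; last by move=> ix; apply: ij0x; split.
  by case: jx => y _ <-; rewrite ext0_emb.
Qed.

Let L1_one_bounded X : `|L1_one X| <= ofR k (fine (vol [set: X])).
Proof.
rewrite L1_normrE ler_ofR.
have -> : fine (vol [set: X]) = \int[adjoin_vol X]_x (cst 1 x).
  by rewrite Rintegral_cst// mul1r.
apply: le_Rintegral => //.
- exact: (integrable_fun_abs (L1_funP (L1Fun (integrable_cst1 X)))).
- exact: finite_measure_integrable_cst.
- by move=> [x|] _ /=; rewrite ?absS1 ?absS0.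
Qed.

Lemma contraction_triangle (U V W : completeNormedModType K)
    (f : contraction U W) (g : contraction V W) u v :
  `|f u + g v| <= `|u| + `|v|.
Proof. by rewrite (le_trans (ler_normD _ _))// lerD// contr_norm. Qed.

Definition L1_B1 : B1_object R k :=
  @B1Object R k L1_functor L1_one L1_one_additive L1_one_bounded
    (fun _ _ _ _ _ _ => contraction_triangle _ _).

Let id_linear : linear (fun z : scalar_space R k => z).
Proof. by []. Qed.

Definition scalar_id : contraction (scalar_space R k) (scalar_space R k) :=
  Contraction id_linear (fun _ => lexx _).

Definition scalar_functor : mea_functor R k :=
  @MeaFunctor R k (fun=> scalar_space R k) (fun _ _ _ => scalar_id)
    (fun _ _ => erefl) (fun _ _ _ _ _ _ => erefl).

Definition total_mass X : scalar_space R k := ofR k (fine (vol [set: X])).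

Let total_mass_additive X Y Z (i : embedding Y X) (j : embedding Z X) :
  complementary i j ->
  fmap scalar_functor i (total_mass Y) + fmap scalar_functor j (total_mass Z)
  = total_mass X.
Proof.
move=> [ij0 ijT].
rewrite [LHS](_ : _ = ofR k (fine (vol [set: Y]) + fine (vol [set: Z]))); last first.
  by rewrite ofRD.
have fin (W : measure_space R) : vol [set: W] \is a fin_num.
  by rewrite ge0_fin_numE ?vol_finite// vol_ge0.
congr ofR; apply: EFin_inj; rewrite EFinD !fineK// (emb_vol i); last exact: msetT.
rewrite (emb_vol j); last exact: msetT.
rewrite -ijT.
have sE (W : measure_space R) (e : embedding W X) :
  vol (range e) = adjoin_vol X [set x | if x is Some y then range e y else False] by [].
rewrite !sE -measureU//.
- exact: range_emb_mset.
- exact: range_emb_mset.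
- apply/seteqP; split=> // -[x|] /= ijx; last by case: ijx.
  by have : (range i `&` range j) x by []; rewrite ij0.
Qed.

Let total_mass_bounded X : `|total_mass X| <= ofR k (fine (vol [set: X])).
Proof.
rewrite [leLHS](normS (ofR k _)) absS_ofR ger0_norm//.
by rewrite fine_ge0// vol_ge0.
Qed.

Definition scalar_B1 : B1_object R k :=
  @B1Object R k scalar_functor total_mass total_mass_additive total_mass_bounded
    (fun _ _ _ _ _ _ => contraction_triangle _ _).

End L1_B1.

(* Main.v *)
(* A map out of (L^1, I) is forced on indicators: the indicator of A is the
   image of I_A under the embedding of the subspace A into X, so naturality
   gives its value.  Linear combinations of indicators are dense in L^1(X),
   hence maps out of (L^1, I) are unique.  Integration is such a map; it is a
   contraction because multiplying f by a scalar of modulus 1 makes its integral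
   nonnegative. *)

From mathcomp Require Import all_boot all_order all_algebra.
From mathcomp Require Import all_classical all_reals all_analysis.
From mathcomp Require Import measurable_realfun.
Require Import Defs.
Set Implicit Arguments.
Unset Strict Implicit.
Unset Printing Implicit Defensive.
Import Order.TTheory GRing.Theory Num.Theory.
Import numFieldNormedType.Exports HBSimple.
Local Open Scope classical_set_scope.
Local Open Scope ring_scope.

(** * Contractions as linear maps *)

Section contraction_theory.
Context (K : numFieldType) (V W : completeNormedModType K).
Implicit Types S T : contraction V W.

Lemma contractionD S u v : S (u + v) = S u + S v.
Proof. by have := contr_linear S 1 u v; rewrite !scale1r. Qed.

Lemma contraction0 S : S 0 = 0.
Proof. by apply: (addIr (S 0)); rewrite -contractionD !add0r. Qed.

Lemma contractionZ S c u : S (c *: u) = c *: S u.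
Proof. by have := contr_linear S c u 0; rewrite contraction0 !addr0. Qed.

Lemma contractionB S u v : S (u - v) = S u - S v.
Proof. by rewrite contractionD -scaleN1r contractionZ scaleN1r. Qed.

Lemma contraction_eqP S T : S =1 T -> S = T.
Proof.
case: S T => [f p q] [g p' q'] /= /funext fg.
by subst g; congr Contraction; exact: Prop_irrelevance.
Qed.

End contraction_theory.

(** * Integration as a map from [L1_B1] to [scalar_B1] *)

Section integral.
Context (R : realType) (k : ground_field).
Local Notation K := (scalar R k).
Implicit Types X Y : measure_space R.

Section one_space.
Context (X : measure_space R).
Local Notation mu := (adjoin_vol X).
Implicit Types f g : L1_fun k X.

Lemma reS_integral f : reS (integral_fun f) = \int[mu]_x reS (extend0 f x).
Proof. exact: reS_mkS. Qed.

(** Over the reals [mkS] drops its second argument, but there [imS] is constantly 0, so the integral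
    on the right vanishes as well. *)
Lemma imS_integral f : imS (integral_fun f) = \int[mu]_x imS (extend0 f x).
Proof.
have [//|[kR h]] := @imS_mkS R k (\int[mu]_x reS (extend0 f x))
  (\int[mu]_x imS (extend0 f x)).
rewrite [LHS]h.
transitivity (\int[mu]_(x in setT) (0 : R)).
  by rewrite Rintegral_cst// mul0r.
by apply: eq_Rintegral => x _; move: (extend0 f x); rewrite kR.
Qed.

Lemma integral_funD f g :
  integral_fun (f + g : L1_fun k X) = integral_fun f + integral_fun g.
Proof.
have [fr fi] := L1_funP f; have [gr gi] := L1_funP g.
apply: scalar_ext.
- rewrite reSD !reS_integral -RintegralD//.
  by apply: eq_Rintegral => x _; rewrite (extend0D f g) reSD.
- rewrite imSD !imS_integral -RintegralD//.
  by apply: eq_Rintegral => x _; rewrite (extend0D f g) imSD.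
Qed.

Lemma integral_funZ (c : K) f :
  integral_fun (c *: f : L1_fun k X) = c * integral_fun f.
Proof.
have [fr fi] := L1_funP f.
have iZ (a : R) (h : adjoin X -> R) : mu.-integrable setT (EFin \o h) ->
    mu.-integrable setT (EFin \o (fun x => a * h x)).
  by move=> ih; have := integrableZl measurableT a ih.
apply: scalar_ext; rewrite ?reSM ?imSM !reS_integral !imS_integral.
- rewrite -!RintegralZl// -RintegralB//; [|exact: iZ..].
  by apply: eq_Rintegral => x _; rewrite (extend0Z c f) reSM.
- rewrite -!RintegralZl// -RintegralD//; [|exact: iZ..].
  by apply: eq_Rintegral => x _; rewrite (extend0Z c f) imSM.
Qed.

Lemma absS_integral f : absS (integral_fun f) <= norm1_fun f.
Proof.
set z := integral_fun f.
have [z0|z0] := eqVneq z 0; first by rewrite z0 absS0 norm1_fun_ge0.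
(* rotate f so that its integral becomes the nonnegative real |z| *)
pose c : K := `|z| / z.
have cz : c * z = ofR k (absS z) by rewrite /c divfK// normS.
have c1 : absS c = 1.
  by rewrite /absS /c normf_div normr_id divff ?normr_eq0// reS1.
(* Now [absS z] is the real part of the integral of [c *: f], and pointwise the real part of
   [c *: f] is at most the modulus of [f]. *)
rewrite -[absS z](@reS_ofR R k) -cz -integral_funZ reS_integral.
apply: le_Rintegral => //.
- by have [] := L1_funP (c *: f).
- exact: integrable_fun_abs (L1_funP f).
- move=> x _; rewrite (extend0Z c f) (le_trans (ler_norm _))//.
  by rewrite (le_trans (absS_re _))// absSM c1 mul1r.
Qed.

Definition L1_integral (u : L1 k X) : scalar_space R k := integral_fun (repr u).

Lemma L1_integralE f : L1_integral (L1_class f) = integral_fun f.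
Proof. by apply: integral_fun_class; rewrite {1}/L1_class reprK. Qed.

Lemma L1_integral_linear : linear L1_integral.
Proof.
move=> c; elim/L1_ind => f; elim/L1_ind => g.
rewrite -[c *: L1_class f]L1_classZ -L1_classD !L1_integralE.
by rewrite integral_funD integral_funZ.
Qed.

Lemma L1_integral_norm u : `|L1_integral u| <= `|u|.
Proof.
elim/L1_ind: u => f; rewrite L1_integralE L1_normrE.
by rewrite [leLHS](normS (integral_fun f)) ler_ofR absS_integral.
Qed.

Definition integral_contraction : contraction (L1 k X) (scalar_space R k) :=
  Contraction L1_integral_linear L1_integral_norm.

End one_space.

(** The nonnegative case [integral_emb] applies to the positive and negative parts of [h]
    separately, since both vanish wherever [h] does. *)
Lemma integral_emb_signed Y X (i : embedding Y X) (h : adjoin X -> \bar R) :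
  measurable_fun [set: adjoin X] h ->
  (forall x, ~ range i x -> h (Some x) = 0%E) ->
  (\int[adjoin_vol X]_x h x = \int[adjoin_vol Y]_y h (adjoin_map i y))%E.
Proof.
move=> mh h0; rewrite integralE [RHS]integralE; congr (_ - _)%E.
- rewrite (integral_emb (i := i) (h := h^\+%E)).
  + by apply: eq_integral => y _; rewrite !funeposE.
  + exact: measurable_funepos.
  + by [].
  + by move=> x /h0 hx; rewrite funeposE hx maxxx.
- rewrite (integral_emb (i := i) (h := h^\-%E)).
  + by apply: eq_integral => y _; rewrite !funenegE.
  + exact: measurable_funeneg.
  + by [].
  + by move=> x /h0 hx; rewrite funenegE hx oppe0 maxxx.
Qed.

Lemma integral_fun_ext0 Y X (i : embedding Y X) (f : L1_fun k Y) :
  integral_fun (L1_fun_ext0 i f) = integral_fun f.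
Proof.
have [mr mi] := L1_funP (L1_fun_ext0 i f).
rewrite /integral_fun; congr mkS; congr fine; rewrite (integral_emb_signed (i := i)).
- by apply: eq_integral => y _; rewrite extend0_ext0.
- exact: measurable_int mr.
- by move=> x nix /=; rewrite ext0_out// reS0.
- by apply: eq_integral => y _; rewrite extend0_ext0.
- exact: measurable_int mi.
- by move=> x nix /=; rewrite ext0_out// imS0.
Qed.

Lemma integral_natural Y X (i : embedding Y X) (u : L1_B1 R k Y) :
  integral_contraction X (fmap (L1_B1 R k) i u)
  = fmap (scalar_B1 R k) i (integral_contraction Y u).
Proof.
elim/L1_ind: u => f /=.
by rewrite L1_extE !L1_integralE integral_fun_ext0.
Qed.

Lemma integral_one X :
  integral_contraction X (B1_elt (L1_B1 R k) X) = B1_elt (scalar_B1 R k) X.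
Proof.
have iE : integral_contraction X (B1_elt (L1_B1 R k) X)
    = integral_fun (L1Fun (integrable_cst1 k X)) := L1_integralE _.
rewrite iE; apply: scalar_ext.
- rewrite reS_integral [RHS]reS_ofR.
  transitivity (\int[adjoin_vol X]_(x in setT) (1 : R)); last first.
    by rewrite Rintegral_cst// mul1r.
  (* The extended function is 0 at the adjoined point [None], so it agrees with the constant 1 only
     almost everywhere; [None] is null. *)
  congr fine; apply: ae_eq_integral => //.
  + exact: measurable_int (L1_funP _).1.
  + have e : Some @^-1` [set None] = set0 :> set X by apply/seteqP; split.
    exists [set None]; split => //.
    * by apply/measurable_adjoin; rewrite e; exact: mset0.
    * by rewrite /= /adjoin_vol e vol0.
    * by move=> [x|//] /= h; case: h => _; rewrite reS1.
- rewrite imS_integral [RHS]imS_ofR.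
  transitivity (\int[adjoin_vol X]_(x in setT) (0 : R)).
    by apply: eq_Rintegral => -[x|] _ /=; rewrite ?imS1 ?imS0.
  by rewrite Rintegral_cst// mul0r.
Qed.

Definition integral_map : B1_map (L1_B1 R k) (scalar_B1 R k) :=
  @B1Map R k (L1_B1 R k) (scalar_B1 R k) integral_contraction
    integral_natural integral_one.

End integral.

(** * Measurable subsets as measure spaces *)

Section subspace.
Context (R : realType) (X : measure_space R) (A : set X) (mA : msets A).
Let S := {x : X | A x}.
Implicit Types B : set S.

Let val_inj_sub : injective (sval : S -> X).
Proof. by move=> x y; apply: eq_sig_hprop => z; exact: Prop_irrelevance. Qed.

Let image_sub B : sval @` B `<=` A.
Proof. by move=> _ [[x Ax] _ <-]. Qed.

Let sub_sigma_algebra : sigma_algebra [set: S] [set B | msets (sval @` B)].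
Proof.
split => /=.
- by rewrite image_set0; exact: mset0.
- move=> B mB; rewrite (_ : _ @` _ = A `&` ~` (sval @` B)).
    by apply: msetI => //; exact: msetC.
  apply/seteqP; split=> [_ [[x Ax] [_ nB] <-]|x [Ax nB]] /=.
    split=> // -[y By yx]; apply: nB.
    by rewrite -(@val_inj_sub y (exist _ x Ax) yx).
  by exists (exist _ x Ax) => //; split=> // Bx; apply: nB; exists (exist _ x Ax).
- by move=> B mB; rewrite image_bigcup; exact: mset_bigcup.
Qed.

Let sub_vol (B : set S) : \bar R := vol (sval @` B).

Let sub_vol0 : sub_vol set0 = 0%E.
Proof. by rewrite /sub_vol image_set0 vol0. Qed.

Let sub_vol_ge0 B : (0 <= sub_vol B)%E.
Proof. exact: vol_ge0. Qed.

Let sub_vol_additive (B : (set S)^nat) :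
  (forall n, msets (sval @` B n)) -> trivIset [set: nat] B ->
  (fun n => \sum_(0 <= i < n) sub_vol (B i))%E @ \oo --> sub_vol (\bigcup_n B n).
Proof.
move=> mB tB; rewrite /sub_vol image_bigcup; apply: vol_sigma_additive => //.
move=> m n _ _ [_ [[y By <-] [z Bz yz]]].
by apply: tB => //; exists y; split=> //; rewrite -(val_inj_sub yz).
Qed.

Let sub_vol_finite : (sub_vol [set: S] < +oo)%E.
Proof.
apply: le_lt_trans (vol_finite X).
have -> : sub_vol setT = vol A.
  congr vol; apply/seteqP; split => [|x Ax]; first exact: image_sub.
  by exists (exist _ x Ax).
(* [A'] is the copy of [A] in [adjoin X], where monotonicity of the measure [adjoin_vol X] is
   available. *)
pose A' : set (adjoin X) := [set y | if y is Some x then A x else False].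
by apply: (@le_measure _ _ _ (adjoin_vol X) A' setT); rewrite ?inE.
Qed.

(** Measurability and volume are read off from images in [X], so the inclusion is an embedding by
    definition. *)
Definition subspace : measure_space R := MeasureSpace sub_sigma_algebra
  sub_vol0 sub_vol_ge0 sub_vol_additive sub_vol_finite.

Definition incl : embedding subspace X :=
  @Embedding R subspace X sval val_inj_sub (fun=> iff_refl _) (fun _ _ => erefl).

End subspace.

(** * Density of simple functions, as an induction principle on [L1] *)

Section L1_density.
Context (R : realType) (k : ground_field) (X : measure_space R).
Local Notation K := (scalar R k).
Local Notation mu := (adjoin_vol X).
Local Notation L1 := (L1 k X).

(** Built as an extension by zero rather than from a function on [X], because naturality evaluates
    maps on exactly this form. *)
Definition L1_indic (A : set X) (mA : msets A) : L1 :=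
  L1_fmap k (incl mA) (L1_one k (subspace mA)).

Lemma L1_indicE (A : set X) (mA : msets A) : exists2 f : L1_fun k X,
  L1_indic mA = L1_class f & forall x, f x = ofR k (\1_A x).
Proof.
exists (L1_fun_ext0 (incl mA) (L1Fun (integrable_cst1 k (subspace mA)))).
  by rewrite /L1_indic /= /L1_one L1_extE.
move=> x /=; rewrite indicE; have [Ax|nAx] := pselect (A x).
  rewrite mem_set// ofR1 -[x in LHS]/(incl mA (exist _ x Ax)).
  by rewrite ext0_emb.
rewrite memNset// ofR0 ext0_out// => -[[y Ay] _ /= yx].
by apply: nAx; rewrite -yx.
Qed.

Definition of_real (h : adjoin X -> R) : X -> K^o := fun x => ofR k (h (Some x)).

(** Equality can fail at [None], where [extend0] gives 0 whatever [h None] is. *)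
Lemma absS_of_real h x : absS (extend0 (of_real h) x) <= `|h x|.
Proof. by case: x => [x|] /=; rewrite ?absS_ofR// absS0. Qed.

Lemma integrable_of_real (h : adjoin X -> R) :
  mu.-integrable setT (EFin \o h) -> of_real h \in @integrable_pred R k X.
Proof.
move=> /integrableP [mh ih]; apply/asboolP.
have mS B : measurable B -> msets [set x | B (h (Some x))].
  move=> mB; have /measurable_EFinP := mh.
  by move=> /(_ measurableT _ mB); rewrite setTI.
have mr : measurable_fun [set: adjoin X] (@reS R k \o extend0 (of_real h)).
  apply: adjoin_measurable_fun => B mB /=.
  by under eq_set do rewrite reS_ofR; exact: mS.
have mi : measurable_fun [set: adjoin X] (@imS R k \o extend0 (of_real h)).
  rewrite (_ : _ \o _ = cst 0)//.
  by apply/funext => -[x|] /=; rewrite ?imS_ofR ?imS0.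
apply: integrable_funP => //; apply: le_lt_trans ih.
apply: ge0_le_integral => //.
- by move=> x _; rewrite lee_fin absS_ge0.
- by apply/measurable_EFinP; exact: measurable_absS.
- by apply: measurableT_comp.
- by move=> x _ /=; rewrite lee_fin absS_of_real.
Qed.

Variable P : L1 -> Prop.
Hypothesis P0 : P 0.
Hypothesis P_lin : forall c u v, P u -> P v -> P (c *: u + v).
Hypothesis P_closed : forall u : L1,
  (forall e : R, 0 < e -> exists2 v, P v & `|u - v| <= ofR k e) -> P u.
Hypothesis P_indic : forall (A : set X) (mA : msets A), P (L1_indic mA).

(** The list [s] is arbitrary so that induction applies: each entry adds a multiple of an indicator.
    An enumeration of the range of [g] then recovers [g] itself. *)
Lemma closed_simple (g : {sfun adjoin X >-> R}) (s : seq R) : exists2 f : L1_fun k X,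
  P (L1_class f) & forall x, f x =
    ofR k (\sum_(y <- s) y * \1_(g @^-1` [set y]) (Some x)).
Proof.
elim: s => [|y s [f Pf fE]].
  by exists 0; [rewrite L1_class0|move=> x; rewrite big_nil ofR0].
have mA : msets (Some @^-1` (g @^-1` [set y]) : set X).
  exact: (measurable_funPTI g (measurable_set1 y)).
have [a aE ax] := L1_indicE mA.
exists (ofR k y *: a + f).
  by rewrite L1_classD L1_classZ -aE; apply: P_lin.
move=> x; rewrite big_cons ofRD ofRM -fE.
by transitivity (ofR k y * a x + f x) => //; rewrite ax.
Qed.

(** An integrable real function is a limit in the L1 norm of simple functions, and [P] passes to
    such limits. *)
Lemma closed_of_real (h : adjoin X -> R) (ih : mu.-integrable setT (EFin \o h)) :
  P (L1_class (L1Fun (integrable_of_real ih))).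
Proof.
have [g [ig _ cg]] := approximation_sfun_integrable measurableT ih.
apply: P_closed => e e0.
have /fine_cvgP [_ /cvgrPdist_lt/(_ _ e0)] := cg.
move=> [n _ /(_ n (leqnn _))] /=.
rewrite sub0r normrN => hg.
have [f Pf fE] := closed_simple (g n) (finmap.enum_fset (fset_set (range (g n)))).
exists (L1_class f) => //.
rewrite -L1_classN -L1_classD L1_normrE ler_ofR.
apply: le_trans (ltW hg); apply: le_trans (ler_norm _).
apply: le_Rintegral => //.
- exact: integrable_fun_abs (L1_funP _).
- have := integrable_abse (integrableB measurableT ih (ig n)).
  by apply: eq_integrable.
- move=> x _.
  rewrite [leLHS](_ : _ = absS (extend0 (of_real (h \- g n)) x)).
    exact: absS_of_real.
  case: x => [x|//] /=; rewrite /of_real /=.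
  congr absS; transitivity (ofR k (h (Some x)) - f x); first by [].
  rewrite fE [g n (Some x)]fimfunE fsbig_finite//=.
  by rewrite /ofR -mkSB subr0.
Qed.

Lemma L1_closed_ind u : P u.
Proof.
elim/L1_ind: u => f; have [fr fi] := L1_funP f.
(* [mkS k 0 1] is the imaginary unit over the complex numbers. Over the reals it is 0, and the
   identity survives because [imS (f x)] is 0. *)
rewrite (_ : f = mkS k 0 1 *: L1Fun (integrable_of_real fi) + L1Fun (integrable_of_real fr)).
  by rewrite L1_classD L1_classZ; apply: P_lin; exact: closed_of_real.
apply: L1_fun_eqP => x.
transitivity (mkS k 0 1 * ofR k (imS (f x)) + ofR k (reS (f x))); last by [].
apply: scalar_ext.
- by rewrite reSD reSM !reS_ofR imS_ofR reS_mkS mulr0 mul0r subr0 add0r.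
- rewrite imSD imSM !imS_ofR reS_ofR reS_mkS mul0r add0r addr0.
  have [->|[kR _]] := @imS_mkS R k 0 1; first by rewrite mul1r.
  by move: (f x); rewrite kR => ?; rewrite mulr0.
Qed.

End L1_density.

(** * Uniqueness of maps out of [L1_B1] *)

Lemma contraction_L1_ext (R : realType) (k : ground_field)
    (X : measure_space R) (W : completeNormedModType (scalar R k))
    (S T : contraction (L1 k X) W) :
  (forall (A : set X) (mA : msets A), S (L1_indic k mA) = T (L1_indic k mA)) ->
  S = T.
Proof.
(* The classes on which [S] and [T] agree form a linear subspace, closed because both maps are
   contractions. *)
move=> ST; apply: contraction_eqP; apply: L1_closed_ind => //.
- by rewrite !contraction0.
- by move=> c u v Su Sv; rewrite !contr_linear Su Sv.
move=> u uP; apply/eqP; rewrite -subr_eq0 -normr_eq0.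
have nE := ge0_scalar (normr_ge0 (S u - T u)).
rewrite nE -(@ofR0 R k) (inj_eq (@ofR_inj R k)) eq_le; apply/andP; split; last first.
  by rewrite -(@ler_ofR R k) -nE ofR0.
apply/ler_addgt0Pr => e e0; rewrite add0r.
(* Since [S v = T v], the difference at [u] is [S (u - v) - T (u - v)], and each term costs at most
   [e / 2]. *)
have [v Pv uv] := uP _ (divr_gt0 e0 (ltr0Sn _ 1)).
rewrite -(@ler_ofR R k) -nE (splitr e) ofRD.
rewrite (_ : S u - T u = S (u - v) - T (u - v)).
  by rewrite (le_trans (ler_normB _ _))// lerD// (le_trans (contr_norm _ _)).
by rewrite !contractionB Pv opprB addrA subrK.
Qed.

Lemma L1_map_unique (R : realType) (k : ground_field) (F : B1_object R k)
    (phi psi : B1_map (L1_B1 R k) F) : phi = psi.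
Proof.
have : B1_comp phi = B1_comp psi.
  apply: functional_extensionality_dep => X.
  apply: contraction_L1_ext => A mA.
  (* The value on the constant 1 of the subspace is prescribed, and naturality along [incl] carries
     it to [X]; the right-hand side is independent of [f]. *)
  have E (f : B1_map (L1_B1 R k) F) :
    f X (L1_indic k mA) = fmap F (incl mA) (B1_elt F (subspace mA)).
    by rewrite -(B1_preserves f) -B1_natural.
  by rewrite !E.
case: phi psi => [f p q] [g p' q'] /= fg.
by subst g; congr B1Map; exact: Prop_irrelevance.
Qed.

Theorem proposition3p8 (R : realType) (k : ground_field) :
  exists psi : B1_map (L1_B1 R k) (scalar_B1 R k),
    (forall phi : B1_map (L1_B1 R k) (scalar_B1 R k), phi = psi) /\
    (forall (X : measure_space R) (f : L1_fun k X),
      psi X (L1_class f) = integral_fun f).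
Proof.
exists (integral_map R k); split; first by move=> phi; exact: L1_map_unique.
by move=> X f; exact: L1_integralE.
Qed.
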